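(* Let $X$ be a gamble, $A$ an event with $A\neq\varnothing$ and $A\neq\Omega$, and $r,q\in\mathbb{R}$ with $r\neq q$. Let $\underline{P}:\mathcal{D}=\{A,\,X|A,\,A(X-r),\,A(X-q)\}\to\mathbb{R}$ be a lower prevision such that $\underline{P}(A(X-r))=\underline{P}(A(X-q))=0$ and $1\geq\underline{P}(A)>0$. Then $\underline{P}$ is $2$-coherent on $\mathcal{D}$ if and only if $$\underline{P}(X|A),\ r,\ q\in[\inf(X|A),\sup(X|A)].$$
   Context: Fix a partition $\mathbb{P}$ of the sure event $\Omega$ into atoms $\omega$. A gamble is a bounded function $X:\mathbb{P}\to\mathbb{R}$. Events are subsets of $\mathbb{P}$, identified with their indicators; $\vee$ denotes union. For a gamble $X$ and an event $B\neq\varnothing$, the conditional gamble $X|B$ is the restriction of $X$ to $B$; thus $\sup(X|B)=\sup_{\omega\in B}X(\omega)$ and $\inf(X|B)=\inf_{\omega\in B}X(\omega)$. An unconditional gamble $X$ is identified with $X|\Omega$. $\underline{P}:\mathcal{D}\to\mathbb{R}$ is $2$-coherent on $\mathcal{D}$ iff for all $X_0|B_0,X_1|B_1\in\mathcal{D}$, all $s_1\geq 0$ and all $s_0\in\mathbb{R}$, setting $S(\underline{s})=\bigvee\{B_i:s_i\neq 0,\ i=0,1\}$ and $\underline{G}_2=s_1B_1(X_1-\underline{P}(X_1|B_1))-s_0B_0(X_0-\underline{P}(X_0|B_0))$, one has $\sup\{\underline{G}_2|S(\underline{s})\}\geq 0$ whenever $S(\underline{s})\neq\varnothing$. *)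

(* Defs.v *)
From HB Require Import structures.
From mathcomp Require Import all_boot all_order all_algebra.
From mathcomp Require Import all_classical all_reals all_analysis.
Set Implicit Arguments.
Unset Strict Implicit.
Unset Printing Implicit Defensive.
Import Order.TTheory GRing.Theory Num.Theory.
Import numFieldNormedType.Exports.
Local Open Scope classical_set_scope.
Local Open Scope ring_scope.

(* The type T is the partition: its elements are the atoms, [set: T] is the
   sure event, and events are sets of atoms. *)
Record gamble (T : Type) (R : realType) := Gamble {
  gamble_fun :> T -> R;
  gamble_bounded : bounded_fun gamble_fun }.

Section Gambles.
Context {T : Type} {R : realType}.
Implicit Types (X Y : gamble T R) (A B : set T).

Lemma bounded_funP (f : T -> R) :
  bounded_fun f <-> exists M : R, forall w, `|f w| <= M.
Proof.
split=> [|[M hM]].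
  case=> M [_ hM]; exists (M + 1) => w.
  by apply: (hM (M + 1)) => //; rewrite ltrDl.
exists M; split; first exact: num_real.
by move=> N /ltW MN w _; apply: le_trans MN.
Qed.

Lemma gamble_eq X Y : X =1 Y -> X = Y.
Proof.
case: X Y => [f hf] [g hg] /= /funext fg.
by subst g; rewrite (Prop_irrelevance hf hg).
Qed.

Lemma indic_bounded A : bounded_fun (\1_A : T -> R).
Proof.
apply/bounded_funP; exists 1 => w.
by rewrite indicE; case: (w \in A); rewrite ?normr1 ?normr0.
Qed.

Definition event_gamble A : gamble T R := Gamble (indic_bounded A).

Lemma restrict_bounded X B : bounded_fun (X \_ B).
Proof.
have /bounded_funP[M hM] := gamble_bounded X.
apply/bounded_funP; exists (Num.max M `|point : R|) => w.
by rewrite /patch; case: ifP => _; rewrite le_max ?hM ?lexx ?orbT.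
Qed.

Definition gamble_restrict X B : gamble T R := Gamble (restrict_bounded X B).

Lemma called_off_bounded A X (c : R) :
  bounded_fun (fun w => \1_A w * (X w - c)).
Proof.
have /bounded_funP[M hM] := gamble_bounded X.
apply/bounded_funP; exists (M + `|c|) => w.
have hB : `|X w - c| <= M + `|c|.
  by rewrite (le_trans (ler_normB _ _))// lerD2r.
rewrite indicE; case: (w \in A); rewrite ?mul1r ?mul0r// normr0.
exact: le_trans hB.
Qed.

(* A(X - c) *)
Definition called_off A X (c : R) : gamble T R :=
  Gamble (called_off_bounded A X c).

End Gambles.

(* A conditional gamble is a function on its conditioning event, represented
   by its extension with the constant value [point] outside that event; hence
   X|B and Y|C are equal iff B = C and X, Y agree on B (see [condP]). *)
Record cgamble (T : Type) (R : realType) := CGamble {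
  cg_gamble :> gamble T R;
  cg_event : set T;
  cg_event_neq0 : cg_event !=set0;
  cg_restrict : gamble_restrict cg_gamble cg_event = cg_gamble }.

Section ConditionalGambles.
Context {T : Type} {R : realType}.
Implicit Types (X Y : gamble T R) (B C : set T).

Lemma gamble_restrict_id X B :
  gamble_restrict (gamble_restrict X B) B = gamble_restrict X B.
Proof. by apply: gamble_eq => w /=; rewrite /patch; case: (w \in B). Qed.

(* X|B *)
Definition cond X B (hB : B !=set0) : cgamble T R :=
  CGamble hB (gamble_restrict_id X B).

Lemma condP X Y B C (hB : B !=set0) (hC : C !=set0) :
  cond X hB = cond Y hC <-> B = C /\ {in B, X =1 Y}.
Proof.
split=> [e|[e XY]].
  have eBC : B = C by exact: (congr1 (@cg_event T R) e).
  split=> // w wB.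
  have : (cond X hB : T -> R) w = (cond Y hC : T -> R) w by rewrite e.
  by rewrite /= /patch -eBC wB.
subst C; rewrite /cond (Prop_irrelevance hC hB).
have eXY : gamble_restrict X B = gamble_restrict Y B.
  by apply: gamble_eq => w /=; rewrite /patch; case: ifP => // /XY.
move: (gamble_restrict_id X B) (gamble_restrict_id Y B); rewrite eXY => p p'.
by rewrite (Prop_irrelevance p p').
Qed.

Definition sup_on (f : T -> R) B : R := sup (f @` B).
Definition inf_on (f : T -> R) B : R := inf (f @` B).

Definition cg_sup (Y : cgamble T R) : R := sup_on Y (cg_event Y).
Definition cg_inf (Y : cgamble T R) : R := inf_on Y (cg_event Y).

Definition stakes_support (Y0 Y1 : cgamble T R) (s0 s1 : R) : set T :=
  [set w | (s0 != 0 /\ cg_event Y0 w) \/ (s1 != 0 /\ cg_event Y1 w)].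

Definition gain2 (P : cgamble T R -> R) (Y0 Y1 : cgamble T R) (s0 s1 : R) :
    T -> R :=
  fun w => s1 * \1_(cg_event Y1) w * (Y1 w - P Y1)
         - s0 * \1_(cg_event Y0) w * (Y0 w - P Y0).

(* A lower prevision on D is given by a total function P of which only the
   values on D are used. *)
Definition coherent2 (D : set (cgamble T R)) (P : cgamble T R -> R) : Prop :=
  forall Y0 Y1 : cgamble T R, D Y0 -> D Y1 ->
  forall s1 s0 : R, 0 <= s1 ->
  stakes_support Y0 Y1 s0 s1 !=set0 ->
  0 <= sup_on (gain2 P Y0 Y1 s0 s1) (stakes_support Y0 Y1 s0 s1).

End ConditionalGambles.

(* Main.v *)
(** Write [p] for [P A]. Up to the factor [s_i], each gamble of the domain
    contributes to the gain either [A - p], or [A (X - c)] with [c] one of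
    [P (X|A)], [r], [q]. On the complement of [A] these are [- p < 0] and [0].
    Hence a gain can be negative there only if [A] is bought, and then on [A] it
    is at least some [b (X - c)], whose supremum over [A] is nonnegative for
    every real [b] exactly when [c] lies between [inf (X|A)] and [sup (X|A)].
    Conversely, if [b (X - c) <= - e < 0] on [A], then for [c = P (X|A)] this is
    itself a sure loss on [A], and for [c = r] or [c = q] buying [A] at the
    small stake [e / 2] extends the loss to the complement of [A]. *)
Require Import Defs.
From HB Require Import structures.
From mathcomp Require Import all_boot all_order all_algebra.
From mathcomp Require Import all_classical all_reals all_analysis.
From mathcomp Require Import ring lra.
Import Order.TTheory GRing.Theory Num.Theory.
Import numFieldNormedType.Exports.
Local Open Scope classical_set_scope.
Local Open Scope ring_scope.

Section SupremumSign.
Context {T : Type} {R : realType}.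
Implicit Types (f : T -> R) (X : gamble T R) (A S : set T) (b c e : R).

(* No boundedness is needed: [sup] is [0] on sets unbounded above. *)
Lemma sup_on_ge0P f S : S !=set0 ->
  0 <= sup_on f S <-> forall e, 0 < e -> exists2 w, S w & - e < f w.
Proof.
move=> [w0 Sw0]; split=> [sup_ge0 e e_gt0|approx].
  apply: contrapT => none; have : sup_on f S <= - e.
    apply: ge_sup; first by exists (f w0); exists w0.
    move=> _ [w Sw <-]; rewrite leNgt; apply/negP => lt_e.
    by apply: none; exists w.
  lra.
have [hs|/sup_out] := pselect (has_sup (f @` S)); last by rewrite /sup_on => ->.
rewrite leNgt; apply/negP => sup_lt0.
have [|w Sw] := approx (- sup_on f S); first lra.
rewrite opprK ltNge => /negP; apply.
by apply: ub_le_sup; [exact: (proj2 hs)|exists w].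
Qed.

(** For nonempty [A] this says that [b * (X - c)] has nonnegative supremum over [A] for every real
    [b]; the pointwise form carries over directly to gains. *)
Definition approx_ge0 X A c :=
  forall b e, 0 < e -> exists2 w, A w & - e < b * (X w - c).

(** Negative [b] is served by points where [X] is near its infimum, positive [b] by points near its
    supremum. Conversely [b = -1] and [b = 1] suffice, with the gap between [c] and the violated
    bound as [e]. *)
Lemma approx_ge0P X A c : A !=set0 ->
  c \in `[inf_on X A, sup_on X A] <-> approx_ge0 X A c.
Proof.
move=> A0; have [w0 Aw0] := A0.
have /Defs.bounded_funP[M XM] := gamble_bounded X.
have im0 : X @` A !=set0 by exists (X w0); exists w0.
have ubX : has_ubound (X @` A).
  by exists M => _ [w _ <-]; rewrite (le_trans (ler_norm _)).
have lbX : has_lbound (X @` A).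
  by exists (- M) => _ [w _ <-]; have := XM w; rewrite ler_norml => /andP[].
rewrite in_itv /=; split=> [/andP[lec gec] b e e_gt0|approx].
  have [b0|b0|->] := ltgtP b 0; last by exists w0; rewrite // mul0r oppr_lt0.
  - have e'_gt0 : 0 < e / - b by rewrite divr_gt0 // oppr_gt0.
    have [_ [w Aw <-] Xw] := inf_adherent e'_gt0 (conj im0 lbX).
    exists w => //; have : X w - c < e / - b.
      by rewrite ltrBlDl (lt_le_trans Xw) // lerD2r.
    rewrite ltr_pdivlMr ?oppr_gt0 //; lra.
  - have e'_gt0 : 0 < e / b by rewrite divr_gt0.
    have [_ [w Aw <-] Xw] := sup_adherent e'_gt0 (conj im0 ubX).
    exists w => //; have : c - X w < e / b.
      by rewrite ltrBlDl -ltrBlDr (le_lt_trans _ Xw) // lerD2r.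
    rewrite ltr_pdivlMr //; lra.
apply/andP; split; rewrite leNgt; apply/negP => out.
- have [|w Aw] := approx (-1) (inf_on X A - c); first lra.
  have : inf_on X A <= X w by apply: ge_inf => //; exists w.
  lra.
- have [|w Aw] := approx 1 (c - sup_on X A); first lra.
  have : X w <= sup_on X A by apply: ub_le_sup => //; exists w.
  lra.
Qed.

End SupremumSign.

Section UnitGain.
Context {T : Type} {R : realType} (P : cgamble T R -> R).
Implicit Types (X : gamble T R) (A : set T) (Y : cgamble T R).

Definition unit_gain Y : T -> R := fun w => \1_(cg_event Y) w * (Y w - P Y).

Lemma gain2E Y0 Y1 (s0 s1 : R) w :
  gain2 P Y0 Y1 s0 s1 w = s1 * unit_gain Y1 w + - s0 * unit_gain Y0 w.
Proof. by rewrite /gain2 /unit_gain; ring. Qed.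

Lemma unit_gain_cond X A (hA : A !=set0) w :
  unit_gain (cond X hA) w = \1_A w * (X w - P (cond X hA)).
Proof.
rewrite /unit_gain /= /patch indicE.
by case: (w \in A); rewrite ?mul0r.
Qed.

Lemma unit_gain_setT X (hT : [set: T] !=set0) w :
  unit_gain (cond X hT) w = X w - P (cond X hT).
Proof. by rewrite unit_gain_cond indicT mul1r. Qed.

Lemma cg_range_cond X A (hA : A !=set0) :
  `[cg_inf (cond X hA), cg_sup (cond X hA)] = `[inf_on X A, sup_on X A].
Proof.
suff im : gamble_restrict X A @` A = X @` A.
  by rewrite /cg_inf /cg_sup /inf_on /sup_on /= im.
by apply: eq_imagel => w Aw; rewrite /= /patch mem_set.
Qed.

End UnitGain.

Section Coherence.
Context {R : realType} {T : Type} (P : cgamble T R -> R) (X : gamble T R).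
Context {A : set T} (hA : A !=set0) (hT : [set: T] !=set0).
Implicit Types (Y : cgamble T R) (D : set (cgamble T R)) (c : R).

Let p := P (cond (event_gamble A) hT).
Let mu := P (cond X hA).

Lemma coherent2_approx_cond D : D (cond X hA) -> coherent2 D P ->
  approx_ge0 X A mu.
Proof.
move=> DX coh b e e_gt0.
have [->|b0] := eqVneq b 0.
  by have [w Aw] := hA; exists w; rewrite // mul0r oppr_lt0.
have S0 : stakes_support (cond X hA) (cond X hA) (- b) 0 !=set0.
  by have [w Aw] := hA; exists w; left; rewrite oppr_eq0.
(* The sign of [s0] is free, so [s0 = - b] alone yields any multiple of [X - mu], and [s1 = 0] keeps
   the support inside [A]. *)
have /(sup_on_ge0P _ _ S0)/(_ e e_gt0) := coh _ _ DX DX 0 (- b) (lexx _) S0.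
move=> [w Sw]; rewrite gain2E mul0r add0r opprK unit_gain_cond.
have Aw : A w by case: Sw => -[].
by rewrite indicE mem_set // mul1r; exists w.
Qed.

Lemma coherent2_approx_called_off D c :
  D (cond (event_gamble A) hT) -> D (cond (called_off A X c) hT) ->
  P (cond (called_off A X c) hT) = 0 -> 0 < p <= 1 ->
  coherent2 D P -> approx_ge0 X A c.
Proof.
move=> DA DXc Pc /andP[p_gt0 p_le1] coh b e e_gt0.
pose YA : cgamble T R := cond (event_gamble A) hT.
pose Yc := cond (called_off A X c) hT.
have s1_gt0 : 0 < e / 2 by rewrite divr_gt0.
have S0 : stakes_support Yc YA (- b) (e / 2) !=set0.
  by have [w _] := hT; exists w; right; rewrite gt_eqF.
(* Off [A] the gain is exactly [- (e / 2 * p)], so this tolerance forces the point into [A]. There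
   [e / 2 * (1 - p) + b * (X w - c)] exceeds the same value, hence [b * (X w - c) > - e / 2]. *)
have d_gt0 : 0 < e / 2 * p by rewrite mulr_gt0.
have /(sup_on_ge0P _ _ S0)/(_ _ d_gt0) := coh _ _ DXc DA _ (- b) (ltW s1_gt0) S0.
move=> [w _]; rewrite gain2E opprK !unit_gain_setT Pc /= -/p indicE.
have [/set_mem Aw|_] := boolP (w \in A) => /= ineq; last lra.
exists w => //; lra.
Qed.

(** Treats [X|A] and the gambles [A (X - c)] uniformly. The last clause ensures that bets
    conditioned on [A] alone share the centre [mu]. *)
Definition centred_bet Y := exists c, [/\ approx_ge0 X A c,
  unit_gain P Y =1 (fun w => \1_A w * (X w - c)) &
  cg_event Y = [set: T] \/ cg_event Y = A /\ c = mu].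

Definition event_bet Y :=
  unit_gain P Y =1 (fun w => \1_A w - p) /\ cg_event Y = [set: T].

Lemma bets_approx_ge0 Y0 Y1 (a0 a1 : R) (hAT : A <> [set: T]) (hp : 0 < p <= 1) :
  event_bet Y0 \/ centred_bet Y0 -> event_bet Y1 \/ centred_bet Y1 ->
  a0 != 0 \/ a1 != 0 -> forall e, 0 < e ->
  exists2 w, (a0 != 0 /\ cg_event Y0 w) \/ (a1 != 0 /\ cg_event Y1 w) &
    - e < a1 * unit_gain P Y1 w + a0 * unit_gain P Y0 w.
Proof.
have [p_gt0 p_le1] := andP hp.
have [w0 nAw0] : exists w, ~ A w.
  by apply/existsNP => allA; apply: hAT; apply/seteqP; split.
have offA : \1_A w0 = 0 :> R by rewrite indicE memNset.
have onA w : A w -> \1_A w = 1 :> R by move=> Aw; rewrite indicE mem_set.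
have mixed_bet Y Y' (a a' : R) : event_bet Y -> centred_bet Y' ->
    a != 0 \/ a' != 0 -> forall e, 0 < e ->
    exists2 w, (a != 0 /\ cg_event Y w) \/ (a' != 0 /\ cg_event Y' w) &
      - e < a * unit_gain P Y w + a' * unit_gain P Y' w.
  move=> [gY evY] [c [appr gY' evY']] a0' e e_gt0.
  (* Selling [A] wins [- a * p] at [w0], where the centred bet pays nothing; buying it adds
     [a * (1 - p) >= 0] on [A]. *)
  have [a_lt0|a_ge0] := ltP a 0.
    exists w0; first by left; rewrite lt_eqF // evY.
    rewrite gY gY' offA; nra.
  have [w Aw lt_w] := appr a' e e_gt0; exists w; last first.
    rewrite gY gY' onA // mul1r; nra.
  case: a0' => h; [by left; rewrite evY|right; split=> //].
  by case: evY' => [->|[-> _]].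
move=> [E0|C0] [E1|C1] a0' e e_gt0.
- have [[g0 ev0] [g1 ev1]] := (E0, E1).
  have inS w : (a0 != 0 /\ cg_event Y0 w) \/ (a1 != 0 /\ cg_event Y1 w).
    by rewrite ev0 ev1; case: a0' => h; [left|right].
  (* Both bets have the same unit gain, so only the total stake matters. *)
  have [t_lt0|t_ge0] := ltP (a0 + a1) 0.
    exists w0; first exact: inS.
    rewrite g0 g1 offA; nra.
  have [w Aw] := hA; exists w; first exact: inS.
  rewrite g0 g1 onA //; nra.
- have [w Sw lt_w] := mixed_bet _ _ _ _ E0 C1 a0' e e_gt0.
  by exists w => //; rewrite addrC.
- have [|w Sw lt_w] := mixed_bet _ _ a1 a0 E1 C0 _ e e_gt0.
    by case: a0'; [right|left].
  by exists w => //; case: Sw; [right|left].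
have [[c0 [appr0 g0 ev0]] [c1 [appr1 g1 ev1]]] := (C0, C1).
(* Centred bets gain 0 at [w0]. If [w0] is outside the support, every bet with nonzero stake is
   conditioned on [A] and centred at [mu]. *)
have [Sw0|nSw0] := pselect
    ((a0 != 0 /\ cg_event Y0 w0) \/ (a1 != 0 /\ cg_event Y1 w0)).
  by exists w0 => //; rewrite g0 g1 offA !mul0r !mulr0 addr0 oppr_lt0.
have AY0 w : A w -> cg_event Y0 w by case: ev0 => [->|[-> _]].
have AY1 w : A w -> cg_event Y1 w by case: ev1 => [->|[-> _]].
(* A bet with zero stake may have another centre, so such bets are split off before the two are
   merged into one multiple of [X - mu]. *)
have [a00|a0N0] := eqVneq a0 0.
  have a1N0 : a1 != 0 by case: a0' => //; rewrite a00 eqxx.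
  have [w Aw lt_w] := appr1 a1 e e_gt0.
  exists w; first by right; split=> //; exact: AY1.
  by rewrite g1 a00 mul0r addr0 onA // mul1r.
have c0E : c0 = mu.
  by case: ev0 => [ev|[]//]; case: nSw0; left; rewrite ev.
have [a10|a1N0] := eqVneq a1 0.
  have [w Aw lt_w] := appr0 a0 e e_gt0.
  exists w; first by left; split=> //; exact: AY0.
  by rewrite g0 a10 mul0r add0r onA // mul1r.
have c1E : c1 = mu.
  by case: ev1 => [ev|[]//]; case: nSw0; right; rewrite ev.
have [w Aw lt_w] := appr0 (a1 + a0) e e_gt0.
exists w; first by left; split=> //; exact: AY0.
by rewrite g0 g1 onA // !mul1r c1E -c0E -mulrDl.
Qed.

Lemma event_bet_cond : event_bet (cond (event_gamble A) hT).
Proof. by split=> // w; rewrite unit_gain_setT. Qed.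

Lemma centred_bet_cond : approx_ge0 X A mu -> centred_bet (cond X hA).
Proof.
by move=> appr; exists mu; split=> //; [exact: unit_gain_cond|right].
Qed.

Lemma centred_bet_called_off c : P (cond (called_off A X c) hT) = 0 ->
  approx_ge0 X A c -> centred_bet (cond (called_off A X c) hT).
Proof.
move=> Pc appr; exists c; split=> //; last by left.
by move=> w; rewrite unit_gain_setT Pc subr0.
Qed.

Lemma bets_coherent2 D (hAT : A <> [set: T]) (hp : 0 < p <= 1) :
  (forall Y, D Y -> event_bet Y \/ centred_bet Y) -> coherent2 D P.
Proof.
move=> betD Y0 Y1 /betD bet0 /betD bet1 s1 s0 _ S0.
apply/(sup_on_ge0P _ _ S0) => e e_gt0.
have sN0 : - s0 != 0 \/ s1 != 0.
  by rewrite oppr_eq0; case: S0 => w [[? _]|[? _]]; [left|right].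
have [w Sw lt_w] := bets_approx_ge0 _ _ _ _ hAT hp bet0 bet1 sN0 _ e_gt0.
by exists w; [rewrite oppr_eq0 in Sw|rewrite gain2E].
Qed.

End Coherence.

Theorem proposition14 (R : realType) (T : Type) (hT : [set: T] !=set0)
    (X : gamble T R) (A : set T) (hA : A !=set0) (hAT : A <> [set: T])
    (r q : R) (hrq : r <> q) (P : cgamble T R -> R)
    (hPr : P (cond (called_off A X r) hT) = 0)
    (hPq : P (cond (called_off A X q) hT) = 0)
    (hPA : 0 < P (cond (event_gamble A) hT) <= 1) :
  coherent2 [set cond (event_gamble A) hT; cond X hA;
                 cond (called_off A X r) hT; cond (called_off A X q) hT] P
  <->
  [/\ P (cond X hA) \in `[cg_inf (cond X hA), cg_sup (cond X hA)],
      r \in `[cg_inf (cond X hA), cg_sup (cond X hA)]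
    & q \in `[cg_inf (cond X hA), cg_sup (cond X hA)]].
Proof.
rewrite cg_range_cond; split=> [coh|[]].
  have DA : [set cond (event_gamble A) hT; cond X hA;
      cond (called_off A X r) hT; cond (called_off A X q) hT]
      (cond (event_gamble A) hT) by left; left; left.
  split; apply/approx_ge0P => //.
  - by apply: coherent2_approx_cond coh; left; left; right.
  - by apply: coherent2_approx_called_off DA _ hPr hPA coh; left; right.
  - by apply: coherent2_approx_called_off DA _ hPq hPA coh; right.
move=> /(approx_ge0P _ _ _ hA) apprX /(approx_ge0P _ _ _ hA) apprr.
move=> /(approx_ge0P _ _ _ hA) apprq.
apply: (bets_coherent2 _ _ hA hT _ hAT hPA) => Y [[[]|]|] ->.
- by left; exact: event_bet_cond.
- by right; exact: centred_bet_cond.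
- by right; exact: centred_bet_called_off.
- by right; exact: centred_bet_called_off.
Qed.
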